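(* Let $n$ be a positive integer. If $A\in\{0,1\}^{n\times n}$ has the $2$-consecutive ones property, then $|\det(A)|\leq 3.936^{n/2}$.
   Context: A $0/1$-matrix has the $2$-consecutive ones property if in every row the $1$-entries form at most $2$ blocks of consecutive entries (maximal runs of ones). *)

(* Defs.v *)
From mathcomp Require Import all_boot all_order all_algebra.

Set Implicit Arguments.
Unset Strict Implicit.
Unset Printing Implicit Defensive.

Import GRing.Theory.
Local Open Scope ring_scope.

Definition zero_one_mx (R : nzRingType) (m n : nat) (A : 'M[R]_(m, n)) : Prop :=
  forall i j, A i j = 0 \/ A i j = 1.

Definition consecutive (n : nat) (B : {set 'I_n}) : bool :=
  [forall j in B, forall l in B, forall k : 'I_n,
     (j <= k <= l)%N ==> (k \in B)].

(* Nonemptiness matters: without it set0 would be a maximal run of a row with  *)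
(* no 1-entries.                                                               *)
Definition ones_run (R : nzRingType) (m n : nat) (A : 'M[R]_(m, n)) (i : 'I_m)
    (B : {set 'I_n}) : bool :=
  [&& B != set0, consecutive B & [forall j in B, A i j == 1]].

Definition ones_blocks (R : nzRingType) (m n : nat) (A : 'M[R]_(m, n))
    (i : 'I_m) : {set {set 'I_n}} :=
  [set B | maxset (ones_run A i) B].

Definition consecutive_ones_property (R : nzRingType) (k m n : nat)
    (A : 'M[R]_(m, n)) : Prop :=
  forall i, (#|ones_blocks A i| <= k)%N.

(* Main.v *)
(* Subtracting from each column of A the preceding one keeps the determinant
   and turns each row into a vector of squared norm at most 4; the rows of
   squared norm 4 have exactly four nonzero entries, +1, -1, +1, -1. Hadamard
   then gives 2 ^ n, and the improvement comes from non-orthogonality.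
   In a family I of pairwise orthogonal rows of squared norm 4, each column x
   meets at most three members: reading the columns cyclically from x, the
   members u meeting x have nonzero entries at x < p_u < y_u < q_u with
   alternating signs, and for u, v with y_u <= y_v orthogonality forces
   y_u <> y_v, p_u <> p_v, and y_u = p_v or q_u = y_v; so the member with the
   least y has at most two companions. Hence 4 #|I| <= 3 n.
   If I is maximal, each row outside I has squared distance at most 15/4 to the
   span of I: a nonzero integral inner product with a member of I costs at
   least 1/4. So det A ^ 2 <= 4 ^ #|I| (15/4) ^ (n - #|I|) <= 240 ^ (n / 4),
   and 240 < 3.936 ^ 4. *)
Require Import Defs.
From mathcomp Require Import all_boot all_order all_algebra.
From mathcomp Require Import reals exp.
From mathcomp Require Import zify ring lra.

Set Implicit Arguments.
Unset Strict Implicit.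
Unset Printing Implicit Defensive.

Import Order.TTheory GRing.Theory Num.Theory.
Local Open Scope ring_scope.

(** * Inner products and a Hadamard inequality relative to an orthogonal set of rows *)

Definition dot (R : pzRingType) (n : nat) (u v : 'rV[R]_n) : R :=
  \sum_k u 0 k * v 0 k.

Lemma dotC (R : comPzRingType) (n : nat) (u v : 'rV[R]_n) : dot u v = dot v u.
Proof. by apply: eq_bigr => k _; rewrite mulrC. Qed.

Lemma dotBl (R : pzRingType) (n : nat) (u v w : 'rV[R]_n) :
  dot (u - v) w = dot u w - dot v w.
Proof. by rewrite -sumrB; apply: eq_bigr => k _; rewrite !mxE mulrBl. Qed.

Lemma dot_sumZl (R : pzRingType) (n : nat) (I : Type) (r : seq I) (P : pred I)
    (c : I -> R) (v : I -> 'rV[R]_n) (w : 'rV[R]_n) :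
  dot (\sum_(i <- r | P i) c i *: v i) w =
  \sum_(i <- r | P i) c i * dot (v i) w.
Proof.
rewrite /dot; under [RHS]eq_bigr do rewrite mulr_sumr.
rewrite exchange_big; apply: eq_bigr => k _.
rewrite summxE mulr_suml; apply: eq_bigr => i _.
by rewrite mxE mulrA.
Qed.

Lemma dot_ge0 (R : realDomainType) (n : nat) (u : 'rV[R]_n) : 0 <= dot u u.
Proof. by apply: sumr_ge0 => k _; rewrite -expr2 sqr_ge0. Qed.

Lemma dot_eq0 (R : realDomainType) (n : nat) (u : 'rV[R]_n) :
  dot u u = 0 -> u = 0.
Proof.
have ge0 (k : 'I_n) : true -> 0 <= u 0 k * u 0 k by rewrite -expr2 sqr_ge0.
move=> /(psumr_eq0P ge0) u0; apply/rowP => k; rewrite mxE.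
by have /eqP := u0 k isT; rewrite mulf_eq0 orbb => /eqP.
Qed.

Lemma dot0r (R : pzRingType) (n : nat) (u : 'rV[R]_n) : dot u 0 = 0.
Proof. by rewrite /dot big1 // => k _; rewrite mxE mulr0. Qed.

(** Expansion along row [i]: the cofactors of that row do not change, and pairing them with another
    row [j] gives entry [(j, i)] of [A *m \adj A], which is 0. *)
Lemma det_subr_rows (R : comPzRingType) (n : nat) (A B : 'M[R]_n) (i : 'I_n)
    (S : {set 'I_n}) (c : 'I_n -> R) :
  i \notin S -> (forall l, l != i -> row l B = row l A) ->
  row i B = row i A - \sum_(j in S) c j *: row j A -> \det B = \det A.
Proof.
move=> iS eqBA rowi.
have eq_cof l : cofactor B i l = cofactor A i l.
  rewrite /cofactor; congr (_ * \det _).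
  apply/matrixP => k m; rewrite !mxE.
  have /eqBA/rowP/(_ (lift l m)) : lift i k != i by rewrite eq_sym neq_lift.
  by rewrite !mxE.
rewrite (expand_det_row B i) (expand_det_row A i).
have eqB l : B i l = A i l - \sum_(j in S) c j * A j l.
  move/rowP/(_ l): rowi; rewrite !mxE => ->; congr (_ - _).
  by rewrite summxE; apply: eq_bigr => j _; rewrite !mxE.
under eq_bigr do rewrite eq_cof eqB mulrBl mulr_suml.
rewrite sumrB exchange_big /= [X in _ - X]big1 ?subr0 // => j jS.
under eq_bigr do rewrite -mulrA.
rewrite -mulr_sumr.
have /matrixP/(_ j i) := mul_mx_adj A.
rewrite !mxE (negPf (_ : j != i)) ?mulr0n; last by apply: contraNneq iS => <-.
by move=> adj0; rewrite (eq_bigr (fun l => A j l * \adj A l i)) ?adj0 ?mulr0 //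
  => l _; rewrite mxE.
Qed.

(** For orthogonal rows this is the component of row [l] orthogonal to their span. A zero row in [S]
    does no harm, as division by 0 gives 0. *)
Definition residual (F : fieldType) (n : nat) (A : 'M[F]_n) (S : {set 'I_n})
    (l : 'I_n) : 'rV[F]_n :=
  row l A - \sum_(j in S)
    (dot (row l A) (row j A) / dot (row j A) (row j A)) *: row j A.

Definition orthogonal_rows (F : pzRingType) (n : nat) (A : 'M[F]_n)
    (S : {set 'I_n}) : Prop :=
  {in S &, forall i j, i != j -> dot (row i A) (row j A) = 0}.

Lemma dot_residual_row (F : realFieldType) (n : nat) (A : 'M[F]_n)
    (S : {set 'I_n}) (l m : 'I_n) :
  orthogonal_rows A S -> m \in S -> dot (residual A S l) (row m A) = 0.
Proof.
move=> orthS mS; rewrite dotBl dot_sumZl (bigD1 m) //=.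
rewrite [X in _ - (_ + X)]big1 => [|j /andP[jS jm]]; last first.
  by rewrite (orthS j m jS mS jm) mulr0.
rewrite addr0; have [/dot_eq0 ->|nz] := eqVneq (dot (row m A) (row m A)) 0.
  by rewrite !dot0r mulr0 subr0.
by rewrite divfK ?subrr.
Qed.

(** Pythagoras: the residual is orthogonal to the projection that was subtracted. *)
Lemma dot_residual (F : realFieldType) (n : nat) (A : 'M[F]_n)
    (S : {set 'I_n}) (l : 'I_n) :
  orthogonal_rows A S ->
  dot (residual A S l) (residual A S l) =
  dot (row l A) (row l A) -
  \sum_(j in S) dot (row l A) (row j A) ^+ 2 / dot (row j A) (row j A).
Proof.
move=> orthS; rewrite {2}/residual dotC dotBl dot_sumZl.
rewrite [X in _ - X]big1 => [|j jS]; last first.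
  by rewrite dotC dot_residual_row ?mulr0.
rewrite subr0 dotC dotBl dot_sumZl; congr (_ - _); apply: eq_bigr => j _.
by rewrite [dot (row j A) (row l A)]dotC expr2 mulrAC.
Qed.

Lemma bessel (F : realFieldType) (n : nat) (A : 'M[F]_n)
    (S : {set 'I_n}) (l : 'I_n) :
  orthogonal_rows A S ->
  0 <= dot (row l A) (row l A) -
    \sum_(j in S) dot (row l A) (row j A) ^+ 2 / dot (row j A) (row j A).
Proof. by move=> orthS; rewrite -dot_residual ?dot_ge0. Qed.

(* Gram-Schmidt outside S: each step replaces a row by its residual, which does
   not change the determinant and only decreases the other factors. *)
Lemma hadamard_orthogonal_rows (F : realFieldType) (n : nat) (A : 'M[F]_n)
    (S : {set 'I_n}) :
  orthogonal_rows A S ->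
  \det A ^+ 2 <=
  \prod_(i in S) dot (row i A) (row i A) *
  \prod_(i in ~: S) (dot (row i A) (row i A) -
    \sum_(j in S) dot (row i A) (row j A) ^+ 2 / dot (row j A) (row j A)).
Proof.
(* Induction on a bound for the size of the complement; [A] is generalised with [S], since each step
   alters a row. *)
elim: {S}_.+1 {-2}S A (ltnSn #|~: S|) => // m IHm S A cardS orthS.
have [/setP S0|[i]] := set_0Vmem (~: S).
  rewrite [X in _ * X]big1 ?mulr1 => [|i]; last by rewrite S0 inE.
  (* All rows lie in [S], so the Gram matrix [A *m A^T] is diagonal and equality holds. *)
  rewrite (expr2 (\det A)) -{2}det_tr -det_mulmx.
  have -> : A *m A^T = diag_mx (\row_i dot (row i A) (row i A)).
    apply/matrixP => i j; rewrite !mxE.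
    have -> : \sum_k A i k * A^T k j = dot (row i A) (row j A).
      by apply: eq_bigr => k _; rewrite !mxE.
    have [->|ij] := eqVneq i j; first by rewrite mulr1n.
    rewrite mulr0n; apply: orthS => //; [have := S0 i | have := S0 j];
      by rewrite !inE => /negbFE.
  rewrite det_diag le_eqVlt; apply/orP; left; apply/eqP.
  apply: eq_big => [i|i _]; last by rewrite mxE.
  by have := S0 i; rewrite !inE => /negbFE ->.
rewrite inE => iS.
pose B := \matrix_(l < n) (if l == i then residual A S i else row l A).
have rowBi : row i B = residual A S i by rewrite rowK eqxx.
have rowB l : l != i -> row l B = row l A by move=> li; rewrite rowK (negPf li).
have neq_i j : j \in S -> j != i by apply: contraTneq => ->.
rewrite -(det_subr_rows iS rowB rowBi).
have orthB : orthogonal_rows B (i |: S).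
  move=> j k; rewrite !inE => /predU1P[->|jS] /predU1P[->|kS] jk.
  - by rewrite eqxx in jk.
  - by rewrite rowBi rowB ?neq_i // dot_residual_row.
  - by rewrite rowBi rowB ?neq_i // dotC dot_residual_row.
  - by rewrite !rowB ?neq_i //; apply: orthS.
apply: le_trans (IHm (i |: S) B _ orthB) _.
  rewrite -ltnS; apply: leq_trans _ cardS; rewrite ltnS.
  by rewrite setCU setIC -setDE (cardsD1 i (~: S)) inE iS.
rewrite big_setU1 //= rowBi dot_residual //.
have eqS : \prod_(j in S) dot (row j B) (row j B) =
           \prod_(j in S) dot (row j A) (row j A).
  by apply: eq_bigr => j jS; rewrite rowB ?neq_i.
rewrite eqS [X in _ <= _ * X](bigD1 i) ?inE //= [leRHS]mulrCA -[leLHS]mulrA.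
apply: ler_wpM2l; first exact: bessel.
apply: ler_wpM2l; first by apply: prodr_ge0 => j _; apply: dot_ge0.
rewrite [leRHS](eq_bigl (mem (~: (i |: S)))); last first.
  by move=> j; rewrite !inE negb_or andbC.
apply: ler_prod => j; rewrite inE => jS; rewrite bessel //=.
move: jS; rewrite !inE negb_or => /andP[ji jS].
rewrite rowB // lerB // big_setU1 //=.
rewrite (eq_bigr (fun k => dot (row j A) (row k B) ^+ 2
  / dot (row k B) (row k B))) => [|k kS]; last by rewrite rowB ?neq_i.
by rewrite lerDr divr_ge0 ?sqr_ge0 ?dot_ge0.
Qed.

(** * Column differences and the determinant *)

(* The entry of row i of A just before column k, with value 0 at k = 0. *)
Definition prev_entry (R : nzRingType) (m n : nat) (A : 'M[R]_(m, n))
    (i : 'I_m) (k : nat) : R :=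
  \sum_(j < n | j.+1 == k) A i j.

Definition diff_mx (R : nzRingType) (m n : nat) (A : 'M[R]_(m, n)) :
    'M[R]_(m, n) :=
  \matrix_(i, j) (A i j - prev_entry A i j).

Lemma prev_entryS (R : nzRingType) (m n : nat) (A : 'M[R]_(m, n)) i (j : 'I_n) :
  prev_entry A i j.+1 = A i j.
Proof. by rewrite /prev_entry (big_pred1 j). Qed.

Lemma prev_entry0 (R : nzRingType) (m n : nat) (A : 'M[R]_(m, n)) i :
  prev_entry A i 0 = 0.
Proof. by rewrite /prev_entry big_pred0. Qed.

Lemma prev_entryP (R : nzRingType) (m n : nat) (A : 'M[R]_(m, n)) i k :
  prev_entry A i k = 0 \/ exists2 j : 'I_n, j.+1 = k & prev_entry A i k = A i j.
Proof.
have [j /eqP <-|no] := pickP (fun j : 'I_n => j.+1 == k).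
  by right; exists j; rewrite ?prev_entryS.
by left; rewrite /prev_entry big_pred0.
Qed.

Lemma prev_entry01 (R : nzRingType) (m n : nat) (A : 'M[R]_(m, n)) i k :
  zero_one_mx A -> prev_entry A i k = 0 \/ prev_entry A i k = 1.
Proof. by move=> A01; case: (prev_entryP A i k) => [|[j _ ->]]; [left|]. Qed.

Lemma sum_diff_mx (R : nzRingType) (m n : nat) (A : 'M[R]_(m, n)) i k :
  (k <= n)%N -> \sum_(j < n | (j < k)%N) diff_mx A i j = prev_entry A i k.
Proof.
move=> kn.
rewrite (eq_bigr (fun j : 'I_n => prev_entry A i j.+1 - prev_entry A i j)).
  rewrite -(big_ord_widen n
    (fun j => prev_entry A i j.+1 - prev_entry A i j) kn).
  rewrite -(big_mkord xpredT
    (fun j => prev_entry A i j.+1 - prev_entry A i j)).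
  by rewrite telescope_sumr // prev_entry0 subr0.
by move=> j _; rewrite mxE prev_entryS.
Qed.

(** Prefix sums recover [A] from its differences, and summing prefixes is multiplication by the
    triangular matrix [U], whose diagonal entries are 1. *)
Lemma det_diff_mx (R : comNzRingType) (n : nat) (A : 'M[R]_n) :
  \det (diff_mx A) = \det A.
Proof.
pose U : 'M[R]_n := \matrix_(k, j) (k <= j)%:R.
have AE : A = diff_mx A *m U.
  apply/matrixP => i j; rewrite -prev_entryS -sum_diff_mx // mxE big_mkcond.
  by apply: eq_bigr => k _; rewrite [U k j]mxE ltnS; case: leqP => _;
    rewrite ?mulr1 ?mulr0.
rewrite {2}AE det_mulmx -(det_tr U) [X in _ * X]det_trig.
  by rewrite big1 ?mulr1 // => k _; rewrite !mxE leqnn.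
by apply/is_trig_mxP => k j kj; rewrite !mxE leqNgt kj.
Qed.

(** * Blocks of ones and the sign pattern of a difference row *)

Definition run_from (R : nzRingType) (m n : nat) (A : 'M[R]_(m, n)) (i : 'I_m)
    (j : 'I_n) : {set 'I_n} :=
  [set k : 'I_n | (j <= k)%N &&
                  [forall l : 'I_n, (j <= l <= k)%N ==> (A i l == 1)]].

Lemma consecutiveP (n : nat) (B : {set 'I_n}) :
  reflect
    (forall j l k : 'I_n, j \in B -> l \in B -> (j <= k <= l)%N -> k \in B)
          (consecutive B).
Proof.
apply: (iffP idP) => [/forallP cB j l k jB lB jkl|cB].
  have /implyP/(_ jB)/forallP/(_ l)/implyP/(_ lB)/forallP/(_ k) := cB j.
  by move=> /implyP/(_ jkl).
apply/forallP => j; apply/implyP => jB; apply/forallP => l; apply/implyP => lB.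
by apply/forallP => k; apply/implyP; apply: cB.
Qed.

(** A one preceded by 0 generates a maximal run of which it is the least element, so distinct starts
    give distinct blocks. *)
Lemma card_starts_le (R : nzRingType) (m n : nat) (A : 'M[R]_(m, n)) i :
  (#|[set j | (A i j == 1%R) && (prev_entry A i j == 0%R)]|
    <= #|ones_blocks A i|)%N.
Proof.
have self j : A i j == 1 -> j \in run_from A i j.
  move=> Aj; rewrite inE leqnn; apply/forallP => l; apply/implyP.
  by rewrite -eqn_leq => /eqP /ord_inj <-.
have inj : {in [set j | (A i j == 1) && (prev_entry A i j == 0)] &,
    injective (run_from A i)}.
  move=> j j'; rewrite !inE => /andP[Aj _] /andP[Aj' _] eqB.
  apply: ord_inj; apply/eqP; rewrite eqn_leq.
  have := self j Aj; rewrite eqB inE => /andP[-> _].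
  by have := self j' Aj'; rewrite -eqB inE => /andP[-> _].
rewrite -(card_in_imset inj).
apply/subset_leq_card/subsetP => _ /imsetP[j + ->].
rewrite inE => /andP[Aj /eqP pj0]; rewrite inE; apply/maxsetP; split.
  apply/and3P; split; first by apply/set0Pn; exists j; apply: self.
    apply/consecutiveP => a b c; rewrite !inE => /andP[ja _].
    move=> /andP[jb /forallP oneb] /andP[ac cb].
    rewrite (leq_trans ja ac); apply/forallP => l; apply/implyP => /andP[jl lc].
    by have /implyP := oneb l; apply; rewrite jl (leq_trans lc cb).
  apply/forallP => k; apply/implyP; rewrite inE => /andP[jk /forallP/(_ k)].
  by rewrite jk leqnn.
move=> B /and3P[_ /consecutiveP cB /forallP oneB] subB.
have jB : j \in B by apply: (subsetP subB); apply: self.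
apply/eqP; rewrite eqEsubset subB andbT; apply/subsetP => k kB.
have [jk|kj] := leqP j k.
  rewrite inE jk; apply/forallP => l; apply/implyP => jlk.
  by have /implyP := oneB l; apply; apply: cB jlk.
(* If [B] reached to the left of [j], it would contain the column [j.-1], whose entry is 0 because
   [j] starts a block. *)
have j0 : (j.-1 < n)%N by apply: leq_ltn_trans (leq_pred _) (ltn_ord j).
have kj1 : (k <= Ordinal j0 <= j)%N.
  by rewrite /= leq_pred -ltnS (ltn_predK kj) kj.
have /implyP/(_ (cB _ _ _ kB jB kj1)) := oneB (Ordinal j0).
by rewrite -prev_entryS /= (ltn_predK kj) pj0 eq_sym oner_eq0.
Qed.

Definition alternating (R : nzRingType) (n : nat) (v : 'rV[R]_n)
    (a b c d : 'I_n) : Prop :=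
  [/\ (a < b)%N, (b < c)%N, (c < d)%N &
   forall k, v 0 k = (k == a)%:R - (k == b)%:R + (k == c)%:R - (k == d)%:R].

Lemma sum_delta_le (R : nzRingType) (n k : nat) (a : 'I_n) :
  \sum_(j < n | (j < k)%N) (j == a)%:R = (a < k)%:R :> R.
Proof.
rewrite big_mkcond (bigD1 a) //= eqxx big1 ?addr0 => [|j /negPf ->].
  by case: ifP.
by case: ifP.
Qed.

Section DiffRows.
Variables (R : numDomainType) (n : nat) (A : 'M[R]_n).
Hypotheses (A01 : zero_one_mx A) (A2 : consecutive_ones_property 2 A).
Variable i : 'I_n.

(** [P] collects the first columns of the blocks, [N] the columns just after a block; a block ending
    in the last column leaves no trace in [N]. *)
Let P := [set j | (A i j == 1) && (prev_entry A i j == 0)].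
Let N := [set j | (A i j == 0) && (prev_entry A i j == 1)].

Lemma diff_mxE j : diff_mx A i j = (j \in P)%:R - (j \in N)%:R.
Proof.
rewrite mxE !inE; case: (A01 i j) => ->; case: (prev_entry01 i j A01) => ->;
by rewrite !eqxx ?[0 == 1]eq_sym ?oner_eq0 /= ?subrr ?subr0 ?sub0r.
Qed.

Lemma disjoint_PN j : j \in P -> j \notin N.
Proof. by rewrite !inE => /andP[/eqP-> _]; rewrite oner_eq0. Qed.

(** The differences of a row sum to its last entry, which is nonnegative. *)
Lemma card_ends_le : (#|N| <= #|P|)%N.
Proof.
have : 0 <= \sum_(j < n) diff_mx A i j.
  rewrite (eq_bigl (fun j : 'I_n => (j < n)%N)) => [|j].
    rewrite sum_diff_mx //.
    by case: (prev_entry01 i n A01) => ->.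
  by rewrite ltn_ord.
under eq_bigr do rewrite diff_mxE.
rewrite sumrB -!natr_sum subr_ge0 ler_nat -!sum1_card.
by rewrite [X in _ -> (X <= _)%N]big_mkcond [X in _ -> (_ <= X)%N]big_mkcond.
Qed.

Lemma dot_diff_row :
  dot (row i (diff_mx A)) (row i (diff_mx A)) = (#|P| + #|N|)%:R.
Proof.
rewrite natrD -!sum1_card !natr_sum !(big_mkcond (fun j => j \in _)) /=.
rewrite -big_split; apply: eq_bigr => j _; rewrite [row _ _ _ _]mxE diff_mxE.
have := @disjoint_PN j; case: (j \in P); case: (j \in N) => /=.
- by move=> /(_ isT).
all: by rewrite ?subr0 ?sub0r ?mulrNN ?mulr0 ?mulr1 ?addr0 ?add0r.
Qed.

Lemma dot_diff_row_le :
  dot (row i (diff_mx A)) (row i (diff_mx A)) != 4 ->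
  dot (row i (diff_mx A)) (row i (diff_mx A)) <= 3.
Proof.
have := A2 i; have := card_starts_le A i; rewrite -/P => leP le2.
rewrite dot_diff_row eqr_nat ler_nat.
by move: card_ends_le; lia.
Qed.

(** Squared norm 4 forces two starts and two ends; they interleave because every prefix sum of the
    differences is 0 or 1. *)
Lemma dot_diff_row4 :
  dot (row i (diff_mx A)) (row i (diff_mx A)) = 4 ->
  exists a b c d, alternating (row i (diff_mx A)) a b c d.
Proof.
have := A2 i; have := card_starts_le A i; rewrite -/P => leP le2.
rewrite dot_diff_row => /eqP; rewrite eqr_nat => /eqP PN4.
have /cards2P[a [c [neq_ac PE]]] : #|P| == 2 by move: card_ends_le; lia.
have /cards2P[b [d [neq_bd NE]]] : #|N| == 2 by move: card_ends_le; lia.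
wlog ac : a c neq_ac PE / (a < c)%N.
  move=> hw; have [ac|ca|/ord_inj ac] := ltngtP a c; first exact: hw ac.
  - by apply: hw ca; rewrite // 1?eq_sym // PE setUC.
  - by rewrite ac eqxx in neq_ac.
wlog bd : b d neq_bd NE / (b < d)%N.
  move=> hw; have [bd|db|/ord_inj bd] := ltngtP b d; first exact: hw bd.
  - by apply: hw db; rewrite // 1?eq_sym // NE setUC.
  - by rewrite bd eqxx in neq_bd.
have vE k : diff_mx A i k =
    (k == a)%:R - (k == b)%:R + (k == c)%:R - (k == d)%:R.
  rewrite diff_mxE PE NE !inE.
  have -> : ((k == a) || (k == c))%:R = (k == a)%:R + (k == c)%:R :> R.
    have [->|_] := eqVneq k a; last by rewrite add0r.
    by rewrite (negPf neq_ac) addr0.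
  have -> : ((k == b) || (k == d))%:R = (k == b)%:R + (k == d)%:R :> R.
    have [->|_] := eqVneq k b; last by rewrite add0r.
    by rewrite (negPf neq_bd) addr0.
  by ring.
(* Before any column, the starts outnumber the ends by 0 or 1. Taking [k] just past [b], [c] and [d]
   yields the order [a < b < c < d]. *)
have part k : (k <= n)%N ->
    ((b < k) + (d < k) <= (a < k) + (c < k) <= 1 + (b < k) + (d < k))%N.
  move=> /(sum_diff_mx A i); under eq_bigr do rewrite vE.
  rewrite sumrB big_split sumrB /= !sum_delta_le => sE.
  case: (prev_entry01 i k A01) => pE; rewrite pE in sE.
  - have /eqP : ((a < k) + (c < k))%:R = ((b < k) + (d < k))%:R :> R.
      by rewrite !natrD; apply/eqP; rewrite -subr_eq0 -sE; apply/eqP; ring.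
    by rewrite eqr_nat; lia.
  - have /eqP : ((a < k) + (c < k))%:R = (1 + (b < k) + (d < k))%:R :> R.
      rewrite !natrD mulr1n.
      set x := (a < k)%:R in sE *; set y := (b < k)%:R in sE *.
      set z := (c < k)%:R in sE *; set t := (d < k)%:R in sE *.
      have -> : x + z = x - y + z - t + y + t by ring.
      by rewrite sE.
    by rewrite eqr_nat; lia.
have ne x y : x \in P -> y \in N -> x != y :> nat.
  by move=> xP yN; apply: contraTneq yN => /ord_inj <-; apply: disjoint_PN.
have := part b.+1 (ltn_ord b); have := part c.+1 (ltn_ord c).
have := part d.+1 (ltn_ord d).
have := ne a b; have := ne a d; have := ne c b; have := ne c d.
rewrite PE NE !inE !eqxx !orbT /= => /(_ isT isT) cd /(_ isT isT) cb.
move=> /(_ isT isT) ad /(_ isT isT) ab pd pc pb.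
exists a, b, c, d; split; [lia | lia | lia |].
by move=> k; rewrite mxE vE.
Qed.

End DiffRows.

(** * Orthogonal families of rows of squared norm 4 *)

(* Cyclic shift of the columns that puts x first. *)
Definition cyc (n : nat) (x k : 'I_n) : nat :=
  if (k < x)%N then (k + n)%N else k.

Lemma cyc_inj (n : nat) (x : 'I_n) : injective (cyc x).
Proof.
move=> j k; rewrite /cyc; have := ltn_ord j; have := ltn_ord k => kn jn jk.
by apply: ord_inj; move: jk; case: ifP => _; case: ifP => _; lia.
Qed.

(** The same sign pattern read cyclically from a nonzero position [x]; the sign [s] records whether
    the entry at [x] is 1 or -1. *)
Definition alternating_from (R : nzRingType) (n : nat) (v : 'rV[R]_n)
    (x p y q : 'I_n) : Prop :=
  [/\ (cyc x x < cyc x p)%N, (cyc x p < cyc x y)%N, (cyc x y < cyc x q)%N &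
   exists s : bool, forall k, v 0 k =
     (-1) ^+ s * ((k == x)%:R - (k == p)%:R + (k == y)%:R - (k == q)%:R)].

Lemma alternating_shift (R : comNzRingType) (n : nat) (v : 'rV[R]_n)
    (a b c d x : 'I_n) :
  alternating v a b c d -> v 0 x != 0 ->
  exists p y q, alternating_from v x p y q.
Proof.
move=> [ab bc cd vE] vx.
have : (x == a) || (x == b) || (x == c) || (x == d).
  apply: contraNT vx; rewrite !negb_or -!andbA => /and4P[xa xb xc xd].
  by rewrite vE (negPf xa) (negPf xb) (negPf xc) (negPf xd) !subr0 addr0.
have an := ltn_ord a; have bn := ltn_ord b; have cn := ltn_ord c.
have dn := ltn_ord d.
case/orP => [/orP[/orP[]|]|] /eqP xE; subst x.
- exists b, c, d; split; [by rewrite /cyc; do 2![case: ifP => ?]; lia.. |].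
  by exists false => k; rewrite vE mul1r.
- exists c, d, a; split; [by rewrite /cyc; do 2![case: ifP => ?]; lia.. |].
  by exists true => k; rewrite vE; ring.
- exists d, a, b; split; [by rewrite /cyc; do 2![case: ifP => ?]; lia.. |].
  by exists false => k; rewrite vE; ring.
- exists a, b, c; split; [by rewrite /cyc; do 2![case: ifP => ?]; lia.. |].
  by exists true => k; rewrite vE; ring.
Qed.

Lemma dot_alternating_from (R : comNzRingType) (n : nat) (u v : 'rV[R]_n)
    (x p y q : 'I_n) :
  alternating_from u x p y q ->
  exists s : bool, dot u v = (-1) ^+ s * (v 0 x - v 0 p + v 0 y - v 0 q).
Proof.
move=> [_ _ _ [s uE]]; exists s; rewrite /dot.
have delta z : \sum_k (k == z)%:R * v 0 k = v 0 z.
  rewrite (bigD1 z) //= eqxx mul1r big1 ?addr0 // => k /negPf ->.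
  by rewrite mul0r.
rewrite -!delta -!sumrB -big_split -sumrB mulr_sumr; apply: eq_bigr => k _ /=.
by rewrite uE; ring.
Qed.

(** The common position [x] contributes 1 to the inner product up to sign, so a coincidence of
    opposite signs must cancel it. The order leaves only [y = p'] or [q = y'] for this. If [y = y'],
    neither can occur; if [p = p'], two cancellations would be needed but [y = p'] is excluded. *)
Lemma orthogonal_alternating_from (R : numDomainType) (n : nat)
    (u v : 'rV[R]_n) (x p y q p' y' q' : 'I_n) :
  alternating_from u x p y q -> alternating_from v x p' y' q' ->
  dot u v = 0 -> (cyc x y <= cyc x y')%N ->
  [/\ y <> y', p <> p' & y = p' \/ q = y'].
Proof.
move=> altu; have [xp py yq _] := altu.
have [s ->] := dot_alternating_from v altu.
move=> [xp' py' yq' [s' vE]] duv yy'.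
pose w z : R := (z == x)%:R - (z == p')%:R + (z == y')%:R - (z == q')%:R.
have w0 : w x - w p + w y - w q = 0.
  apply/eqP; move/eqP: duv; rewrite !vE -!/(w _).
  have -> : (-1) ^+ s' * w x - (-1) ^+ s' * w p + (-1) ^+ s' * w y -
    (-1) ^+ s' * w q = (-1) ^+ s' * (w x - w p + w y - w q) by ring.
  by rewrite !mulf_eq0 !signr_eq0.
pose e (j k : 'I_n) : nat := j == k.
(* Coincidences of equal signs on the left, of opposite signs on the right: orthogonality becomes an
   equation between natural numbers. *)
have /eqP : (e x x + e x y' + e p p' + e p q' + e y x + e y y' + e q p' +
    e q q')%N%:R = (e x p' + e x q' + e p x + e p y' + e y p' + e y q' + e q x +
    e q y')%N%:R :> R.
  apply/eqP; rewrite -subr_eq0 -w0 /w -!/(e _ _) !natrD; apply/eqP; ring.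
rewrite eqr_nat.
(* Injectivity of [cyc] turns everything into arithmetic on shifted positions. *)
have eE j k : e j k = (cyc x j == cyc x k) by rewrite (inj_eq (@cyc_inj n x)).
rewrite !eE eqxx.
have neq j k : cyc x j <> cyc x k -> j <> k by move=> + jk; rewrite jk.
have eq j k : cyc x j = cyc x k -> j = k by apply: cyc_inj.
move: xp py yq xp' py' yq' yy'.
have -> : [/\ y <> y', p <> p' & y = p' \/ q = y'] <->
    [/\ cyc x y <> cyc x y', cyc x p <> cyc x p' &
        cyc x y = cyc x p' \/ cyc x q = cyc x y'].
  split=> -[yy pp yq]; split; try exact: neq; try by move/cyc_inj.
  - by case: yq => ->; [left|right].
  - by case: yq => /eq ->; [left|right].
move: (cyc x x) (cyc x p) (cyc x y) (cyc x q) (cyc x p') (cyc x y') (cyc x q').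
move=> {e eE w w0 neq eq vE altu duv p y q p' y' q'} X p y q p' y' q'.
move=> xp py yq xp' py' yq' yy' /eqP.
rewrite (ltn_eqF xp') (ltn_eqF (ltn_trans xp' py')).
rewrite (ltn_eqF (ltn_trans xp' (ltn_trans py' yq'))).
rewrite (gtn_eqF xp) (gtn_eqF (ltn_trans xp py)).
rewrite (gtn_eqF (ltn_trans xp (ltn_trans py yq))) /=.
have yq0 := ltn_eqF (leq_ltn_trans yy' yq').
have py0 := ltn_eqF (leq_trans py yy').
have pq0 := ltn_eqF (ltn_trans py (leq_ltn_trans yy' yq')).
by rewrite yq0 py0 pq0; do 6![case: eqP => ?]; move=> /= eq_e; split; lia.
Qed.

Lemma column_degree_le (R : numDomainType) (n : nat) (B : 'M[R]_n)
    (I : {set 'I_n}) (x : 'I_n) :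
  orthogonal_rows B I ->
  {in I, forall i, exists a b c d, alternating (row i B) a b c d} ->
  (#|[set i in I | B i x != 0%R]| <= 3)%N.
Proof.
move=> orthI altI; set J := [set i in I | _].
(* [f i] packs the positions [((p, y), q)] of row [i]; [(x, x, x)] is a dummy value outside [J]. *)
have /fin_all_exists[f fP] (i : 'I_n) : exists t : 'I_n * 'I_n * 'I_n,
    i \in J -> alternating_from (row i B) x t.1.1 t.1.2 t.2.
  have [|] := boolP (i \in J); last by exists (x, x, x).
  rewrite inE => /andP[/altI[a [b [c [d alti]]]] Bix].
  have [|p [y [q altx]]] := alternating_shift (x := x) alti.
    by rewrite mxE.
  by exists (p, y, q).
have pairP : {in J &, forall u v, u != v ->
    (cyc x (f u).1.2 <= cyc x (f v).1.2)%N ->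
    [/\ (f u).1.2 <> (f v).1.2, (f u).1.1 <> (f v).1.1 &
        (f u).1.2 = (f v).1.1 \/ (f u).2 = (f v).1.2]}.
  move=> u v uJ vJ uv le_uv.
  apply: orthogonal_alternating_from (fP u uJ) (fP v vJ) _ le_uv.
  by move: uJ vJ; rewrite !inE => /andP[uI _] /andP[vI _]; apply: orthI.
have [->|[i0 i0J]] := set_0Vmem J; first by rewrite cards0.
have [u uJ umin] := @arg_minnP _ i0 (mem J) (fun u => cyc x (f u).1.2) i0J.
have {}uJ : u \in J by [].
(* The companions [v] of [u] inject into the booleans by testing [y_u = p_v]: two with value true
   would share [p], two with value false would share [y = q_u], and both are excluded. *)
rewrite (cardsD1 u J) uJ add1n ltnS -card_bool.
apply: (@leq_card_in _ _ (fun v => (f u).1.2 == (f v).1.1)) => v w.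
rewrite !inE -/J => /andP[vu vJ] /andP[wu wJ] /= eq_vw.
have {}vJ : v \in J by rewrite inE.
have {}wJ : w \in J by rewrite inE.
apply/eqP/negPn/negP => vw.
have [neqy neqp] : (f v).1.2 <> (f w).1.2 /\ (f v).1.1 <> (f w).1.1.
  have [le|le] := orP (leq_total (cyc x (f v).1.2) (cyc x (f w).1.2)).
    by have [] := pairP v w vJ wJ vw le.
  rewrite eq_sym in vw; have [ne1 ne2 _] := pairP w v wJ vJ vw le.
  by split => /esym.
have qy z : z \in J -> z != u -> (f u).1.2 != (f z).1.1 -> (f u).2 = (f z).1.2.
  rewrite eq_sym => zJ zu nyp.
  have [_ _ []//] := pairP u z uJ zJ zu (umin z zJ).
  by move=> yp; rewrite yp eqxx in nyp.
move: eq_vw; have [yp_v /esym/eqP yp_w|nyp_v /esym/negbT nyp_w] := eqVneq.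
  by apply: neqp; rewrite -yp_v.
by apply: neqy; rewrite -(qy v) // -(qy w).
Qed.

(** Double counting of nonzero entries: four in each row of [I], at most three in each column. *)
Lemma alternating_family_le (R : numDomainType) (n : nat) (A : 'M[R]_n)
    (I : {set 'I_n}) :
  zero_one_mx A -> consecutive_ones_property 2 A ->
  orthogonal_rows (diff_mx A) I ->
  {in I, forall i, dot (row i (diff_mx A)) (row i (diff_mx A)) = 4} ->
  (4 * #|I| <= 3 * n)%N.
Proof.
move=> A01 A2 orthI norm4; set B := diff_mx A in orthI norm4 *.
have degree x := column_degree_le x orthI
  (fun i iI => dot_diff_row4 A01 A2 (norm4 i iI)).
have sqrB i j : B i j * B i j = (B i j != 0)%:R.
  rewrite (diff_mxE A01) -/B.
  case: (_ \in _); case: (_ \in _) => /=;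
  by rewrite ?subrr ?subr0 ?sub0r ?oppr_eq0 ?oner_eq0 ?eqxx ?mulrNN ?mulr0
    ?mulr1.
rewrite -(ler_nat R) mulnC natrM mulr_natl -sumr_const.
rewrite -(eq_bigr _ norm4) /dot exchange_big /=.
rewrite mulnC natrM mulr_natl -[X in _ *+ X]card_ord -sumr_const.
apply: ler_sum => x _.
apply: le_trans (_ : #|[set i in I | B i x != 0]|%:R <= _).
  rewrite -sum1_card natr_sum.
  rewrite [leLHS](eq_bigr (fun i => (B i x != 0)%:R)) => [|i _]; last first.
    by rewrite [row _ _ _ _]mxE sqrB.
  rewrite [leRHS](eq_bigl (fun i => (i \in I) && (B i x != 0))) => [|i].
    by rewrite big_mkcondr; apply: ler_sum => i _; case: (B i x != 0).
  by rewrite inE.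
by rewrite ler_nat degree.
Qed.

(** * The determinant bound *)

Lemma det_two_blocks_exp8_le (R : archiRealFieldType) (n : nat) (A : 'M[R]_n) :
  zero_one_mx A -> consecutive_ones_property 2 A ->
  \det A ^+ 8 <= 240 ^+ n.
Proof.
move=> A01 A2; rewrite -det_diff_mx; set B := diff_mx A.
pose d i j := dot (row i B) (row j B).
pose Q (S : {set 'I_n}) := [forall i in S, (d i i == 4) &&
  [forall j in S, (i != j) ==> (d i j == 0)]].
have QP S : Q S -> orthogonal_rows B S /\ {in S, forall i, d i i = 4}.
  move=> /forallP QS; split=> [i j iS jS ij|i iS].
    have /implyP/(_ iS)/andP[_ /forallP/(_ j)] := QS i.
    by move=> /implyP/(_ jS)/implyP/(_ ij)/eqP.
  by have /implyP/(_ iS)/andP[/eqP] := QS i.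
have [|I /maxsetP[QI maxI] _] := @maxset_exists _ Q set0.
  by apply/forallP => i; rewrite inE.
have [orthI norm4] := QP I QI.
have cardI := alternating_family_le A01 A2 orthI norm4.
have outside i : i \in ~: I ->
    d i i - \sum_(j in I) d i j ^+ 2 / d j j <= 15 / 4.
  rewrite inE => iI.
  have [dii|dii] := eqVneq (d i i) 4; last first.
    apply: le_trans (_ : d i i <= _); last first.
      by apply: le_trans (dot_diff_row_le A01 A2 dii) _; lra.
    rewrite lerBlDr lerDl sumr_ge0 // => j _.
    by rewrite divr_ge0 ?sqr_ge0 ?dot_ge0.
  (* A row of squared norm 4 orthogonal to all of [I] could be added to [I], against maximality. *)
  have /existsP[j /andP[jI dij]] : [exists j, (j \in I) && (d i j != 0)].
    apply: contraNT iI; rewrite negb_exists => /forallP noj.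
    rewrite -(maxI (i |: I)) ?setU11 ?subsetUr //.
    have dij0 j : j \in I -> d i j = 0.
      by move=> jI; have := noj j; rewrite jI => /negPn/eqP.
    apply/forallP => j; apply/implyP; rewrite !inE => /predU1P[->|jI].
      rewrite dii eqxx /=; apply/forallP => k; apply/implyP; rewrite !inE.
      by move=> /predU1P[->|/dij0 ->]; rewrite ?eqxx ?implybT.
    rewrite norm4 // eqxx /=; apply/forallP => k; apply/implyP; rewrite !inE.
    move=> /predU1P[->|kI].
      by rewrite /d dotC -/(d i j) dij0 ?eqxx ?implybT.
    by apply/implyP => jk; apply/eqP; apply: orthI.
  (* A nonzero integer has square at least 1, so the term of [j] is at least 1/4. *)
  have int_d : d i j \is a Num.int.
    apply: rpred_sum => k _; apply: rpredM; rewrite mxE (diff_mxE A01);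
    by apply: rpredB; apply: natr_int.
  have := sqr_intr_ge1 int_d dij.
  rewrite dii (bigD1 j) //= norm4 //.
  have : 0 <= \sum_(k in I | k != j) d i k ^+ 2 / d k k.
    by apply: sumr_ge0 => k _; rewrite divr_ge0 ?sqr_ge0 ?dot_ge0.
  lra.
have := hadamard_orthogonal_rows orthI.
rewrite (eq_bigr (fun=> 4) norm4) prodr_const => detB.
have {detB} : \det B ^+ 2 <= 4 ^+ #|I| * (15 / 4) ^+ #|~: I|.
  apply: le_trans detB _; apply: ler_wpM2l; first by rewrite exprn_ge0.
  rewrite -prodr_const; apply: ler_prod => i iI.
  by rewrite outside // andbT bessel.
rewrite (exprM _ 2 4) => det2.
have cardC : (#|I| + #|~: I| = n)%N by rewrite cardsC card_ord.
set k := #|I| in cardI cardC det2; set m := #|~: I| in cardC det2.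
apply: le_trans (_ : (4 ^+ k * (15 / 4) ^+ m) ^+ 4 <= _).
  by rewrite lerXn2r ?nnegrE ?sqr_ge0 // mulr_ge0 ?exprn_ge0 // divr_ge0.
(* [4 * k <= 3 * n] with [n = k + m] means [k <= 3 * m]; [r] is the slack, and each unit of it gains
   a factor [t]. *)
have [r kr] : exists r, (m * 3 = k + r)%N by exists (m * 3 - k)%N; lia.
pose t : R := 15 / 16.
have e4 : (4 : R) ^+ 4 * t = 240 by rewrite /t; field.
have e15 : (15 / 4 : R) ^+ 4 = 240 * t ^+ 3 by rewrite /t; field.
have -> : (4 ^+ k * (15 / 4) ^+ m) ^+ 4 = 240 ^+ n * t ^+ r :> R.
  have -> : (4 ^+ k * (15 / 4) ^+ m) ^+ 4 = (4 ^+ 4) ^+ k * ((15 / 4) ^+ 4) ^+ m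
      :> R by rewrite exprMn exprAC [X in _ * X]exprAC.
  rewrite e15 (exprMn m 240) -(exprM t) mulnC kr -cardC !exprD.
  rewrite -[X in _ = X ^+ k * _ * _]e4 (exprMn k (4 ^+ 4)) !mulrA.
  by congr (_ * _); apply: mulrAC.
by rewrite ler_piMr ?exprn_ge0 // exprn_ile1 // /t; lra.
Qed.

Theorem theorem10 (R : realType) (n : nat) (n_gt0 : (0 < n)%N) (A : 'M[R]_n)
    (A01 : zero_one_mx A) (A2 : consecutive_ones_property 2 A) :
  `|\det A| <= (3936%:R / 1000%:R) `^ (n%:R / 2%:R).
Proof.
set c : R := 3936%:R / 1000%:R; have c_ge0 : 0 <= c by rewrite divr_ge0.
(* The eighth power turns the real exponent [n / 2] into the natural number [4 * n]. *)
rewrite -(ler_pXn2r (ltn0Sn 7)) ?nnegrE ?powR_ge0 //.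
rewrite -normrX ger0_norm; last by rewrite (exprM _ 2 4) exprn_ge0 ?sqr_ge0.
rewrite -[leRHS]powR_mulrn ?powR_ge0 // -powRrM.
have -> : n%:R / 2%:R * 8%:R = (4 * n)%:R :> R by rewrite natrM; field.
rewrite powR_mulrn // exprM; apply: le_trans (det_two_blocks_exp8_le A01 A2) _.
(* The numerical margin is thin: [c ^+ 4] is about 240.005. *)
rewrite lerXn2r ?nnegrE ?exprn_ge0 //; rewrite /c; lra.
Qed.
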